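(* Let $(D,N,R)\in\mathbb Z^3$ with $D>0$, $N\ge 4$, $R>0$ and $f(D,N,R):=DNR-D^2-NR^2<0$. Let $$\operatorname{Orb}^+(D,N,R):=\{(D',N,R')\in\operatorname{Orb}(D,N,R): D'>0,\ R'>0\}.$$ Then $\operatorname{Orb}^+(D,N,R)$ is an infinite proper subset of $\operatorname{Orb}(D,N,R)$, and it contains no point $(D_1,N,R_1)$ satisfying $$0<\tfrac{2D_1}{N}\le R_1\le \tfrac{D_1}2,$$ but it does contain a unique point $(D_0,N,R_0)$ such that $D_0\le D'$ and $R_0\le R'$ for all $(D',N,R')\in\operatorname{Orb}^+(D,N,R)$. Moreover, with this $(D_0,N,R_0)$: (1) If $R_0\notin\{\frac{D_0}N,D_0\}$, then no $\mathrm{TFF}(D',N,R')$ exists for any $(D',N,R')\in\operatorname{Orb}(D,N,R)$. (2) If $R_0\in\{\frac{D_0}N,D_0\}$, then a $\mathrm{TFF}(D_0,N,R_0)$ exists, and $\operatorname{Orb}^+(D,N,R)$ is the set of triples $(D',N,R')$ for which there exists a $\mathrm{TFF}(D',N,R')$ that can be obtained from a $\mathrm{TFF}(D_0,N,R_0)$ via iterated alternating Naimark and spatial complements. In this case, any such $\mathrm{TFF}(D',N,R')$ is necessarily equichordal, but can only be equi-isoclinic if $R'=R_0$ and $D'\in\{D_0,NR_0-D_0\}$. Moreover, in this case $(D_0,N,R_0)$ is the only point $(D',N,R')\in\operatorname{Orb}^+(D,N,R)$ with $R'\in\{\frac{D'}N,D'\}$.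
   Context: Orbits. Let $\nu,\sigma:\mathbb R^3\to\mathbb R^3$ be the involutions $\nu(D,N,R):=(NR-D,N,R)$ and $\sigma(D,N,R):=(D,N,D-R)$. For $(D,N,R)\in\mathbb Z^3$ with $N>1$, $\operatorname{Orb}(D,N,R)$ denotes the orbit of $(D,N,R)$ under the action of the group generated by $\nu$ and $\sigma$. Tight fusion frames. Let $D,N,R$ be positive integers with $N>1$. A $\mathrm{TFF}(D,N,R)$ is a sequence $\{\mathcal U_n\}_{n=1}^N$ of $R$-dimensional subspaces of a $D$-dimensional complex Hilbert space $\mathcal H$ whose orthogonal projections $\mathbf P_n$ satisfy $\sum_{n=1}^N\mathbf P_n=A\mathbf I$ for some $A>0$ (necessarily $A=\frac{NR}D\ge1$). By convention no $\mathrm{TFF}(D,N,R)$ exists if $D\le0$ or $R\le 0$. It is equichordal if $\operatorname{Tr}(\mathbf P_{n_1}\mathbf P_{n_2})$ is constant over all $n_1\neq n_2$, and equi-isoclinic if there exists $\lambda\ge0$ with $\mathbf P_{n_1}\mathbf P_{n_2}\mathbf P_{n_1}=\lambda\mathbf P_{n_1}$ for all $n_1\ne n_2$. Complements. If $D\ne R$, the spatial complement of a $\mathrm{TFF}(D,N,R)$ $\{\mathcal U_n\}$ is $\{\mathcal U_n^\perp\}$, which is a $\mathrm{TFF}(D,N,D-R)$. If $D\neq NR$, a Naimark complement of a $\mathrm{TFF}(D,N,R)$ $\{\mathcal U_n\}$ is defined as follows: choose isometries $\boldsymbol\Phi_n:\mathbb C^R\to\mathcal H$ with range $\mathcal U_n$;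 a Naimark complement is a sequence $\{\mathcal V_n\}_{n=1}^N$ of subspaces of an $(NR-D)$-dimensional Hilbert space $\mathcal K$ where $\mathcal V_n$ is the range of an isometry $\boldsymbol\Psi_n:\mathbb C^R\to\mathcal K$ and $\boldsymbol\Psi_{n_1}^*\boldsymbol\Psi_{n_2}=-\frac{D}{NR-D}\boldsymbol\Phi_{n_1}^*\boldsymbol\Phi_{n_2}$ for all $n_1\ne n_2$. It exists, is unique up to unitaries, and is a $\mathrm{TFF}(NR-D,N,R)$. A $\mathrm{TFF}(D,N,R)$ with $D=R$ has no spatial complement and one with $D=NR$ has no Naimark complement. ''Obtained via iterated alternating Naimark and spatial complements'' means obtained by a finite (possibly zero) number of successive complements, alternating between Naimark and spatial, beginning with either type. *)

(* Defs.v *)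
From mathcomp Require Import all_boot all_order all_algebra.
From mathcomp Require Import sesquilinear spectral.
From mathcomp Require Import complex.
From mathcomp Require Import boolp classical_sets cardinality reals.

Set Implicit Arguments.
Unset Strict Implicit.
Unset Printing Implicit Defensive.

Import Order.TTheory GRing.Theory Num.Theory.
Local Open Scope ring_scope.
Local Open Scope sesquilinear_scope.
Local Open Scope classical_set_scope.

(* Triples (D, N, R); nu and sigma preserve the integer points, so only their
   restrictions to Z^3 are needed. *)
Definition triple : Type := (int * int * int)%type.

Definition nu (p : triple) : triple :=
  let: (D, N, R) := p in (N * R - D, N, R).

Definition sigma (p : triple) : triple :=
  let: (D, N, R) := p in (D, N, D - R).

Inductive nu_sigma_group : (triple -> triple) -> Prop :=
| nsg_id : nu_sigma_group id
| nsg_nu : nu_sigma_group nu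
| nsg_sigma : nu_sigma_group sigma
| nsg_comp g h :
    nu_sigma_group g -> nu_sigma_group h -> nu_sigma_group (g \o h)
| nsg_inv g h :
    nu_sigma_group g -> cancel g h -> cancel h g -> nu_sigma_group h.

Definition Orb (D N R : int) : set triple :=
  [set q | exists2 g, nu_sigma_group g & q = g (D, N, R)].

(* The elements of Orb D N R all have second component N. *)
Definition Orb_pos (D N R : int) : set triple :=
  [set q | Orb D N R q /\ 0 < q.1.1 /\ 0 < q.2].

Definition f (D N R : int) : int := D * N * R - D ^+ 2 - N * R ^+ 2.

Definition least_point (S : set triple) (D N R : int) : Prop :=
  S (D, N, R) /\ forall D' R' : int, S (D', N, R') -> D <= D' /\ R <= R'.

(* A sequence of N subspaces of C^D, the standard D-dimensional complex Hilbert
   space of row vectors with inner product u *m v^t*.  The n-th subspace is the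
   row space of the n-th matrix.  Matrices act on the right, so an operator
   product S T (T first) reads T *m S.  All notions below depend on the row
   spaces only. *)
Definition subspaces (K : realType) (D N : int) : Type :=
  'I_(absz N) -> 'M[K[i]]_(absz D).

Section Frames.
Variable K : realType.

Definition orthocomp (d : nat) (U : 'M[K[i]]_d) : 'M[K[i]]_d :=
  orthomx Num.conj (mx_of_hermitian (hermitian1mx _)) U.

Definition is_TFF (D N R : int) (U : subspaces K D N) : Prop :=
  [/\ 0 < D, 1 < N, 0 < R,
      forall n, (\rank (U n))%:Z = R
    & exists2 A : K[i], 0 < A & \sum_n proj_ortho (U n) = A%:M].

Definition TFF_exists (D N R : int) : Prop :=
  exists U : subspaces K D N, is_TFF R U.

Definition equichordal (D N : int) (U : subspaces K D N) : Prop :=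
  exists c : K[i], forall n1 n2, n1 != n2 ->
    \tr (proj_ortho (U n1) *m proj_ortho (U n2)) = c.

Definition equi_isoclinic (D N : int) (U : subspaces K D N) : Prop :=
  exists2 l : K[i], 0 <= l & forall n1 n2, n1 != n2 ->
    proj_ortho (U n1) *m proj_ortho (U n2) *m proj_ortho (U n1)
      = l *: proj_ortho (U n1).

Definition spatial_complement (D N R : int) (U V : subspaces K D N) : Prop :=
  D <> R /\ forall n, (V n :=: orthocomp (U n))%MS.

(* A matrix Phi is unitary when Phi *m Phi^t* = 1, i.e. x |-> x *m Phi is an
   isometry; Phi_n1^* Phi_n2 then has matrix Phi n2 *m (Phi n1)^t*. *)
Definition naimark_complement (D N R : int)
    (U : subspaces K D N) (V : subspaces K (N * R - D) N) : Prop :=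
  D <> N * R /\
  exists (Phi : 'I_(absz N) -> 'M[K[i]]_(absz R, absz D))
         (Psi : 'I_(absz N) -> 'M[K[i]]_(absz R, absz (N * R - D)%R)),
    [/\ forall n, Phi n \is unitarymx /\ (Phi n :=: U n)%MS,
        forall n, Psi n \is unitarymx /\ (Psi n :=: V n)%MS
      & forall n1 n2, n1 != n2 ->
          Psi n2 *m (Psi n1)^t* =
            - (D%:~R / (N * R - D)%:~R) *: (Phi n2 *m (Phi n1)^t*)].

Arguments naimark_complement {D N} R U V.

Inductive complement_kind := Naimark | Spatial.

(* [alternating_complements R0 U0 k R U]: U is obtained from U0 by finitely many
   complements, no two successive ones of the same kind; k is the kind of the
   last one, if any. *)
Inductive alternating_complements (D0 N R0 : int) (U0 : subspaces K D0 N) :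
    option complement_kind ->
    forall D : int, int -> subspaces K D N -> Prop :=
| ac_zero (U : subspaces K D0 N) :
    (forall n, (U n :=: U0 n)%MS) ->
    alternating_complements R0 U0 None R0 U
| ac_naimark k (D R : int) (U : subspaces K D N)
    (V : subspaces K (N * R - D) N) :
    k <> Some Naimark ->
    alternating_complements R0 U0 k R U ->
    naimark_complement R U V ->
    alternating_complements R0 U0 (Some Naimark) R V
| ac_spatial k (D R : int) (U V : subspaces K D N) :
    k <> Some Spatial ->
    alternating_complements R0 U0 k R U ->
    spatial_complement R U V ->
    alternating_complements R0 U0 (Some Spatial) (D - R) V.

Definition TFF_obtained_from (D0 N R0 D R : int) (U : subspaces K D N) : Prop :=
  is_TFF R U /\
  exists U0 : subspaces K D0 N, is_TFF R0 U0 /\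
    exists k, alternating_complements R0 U0 k R U.

End Frames.

(* Main.v *)
(* Every orbit consists of the alternating words in nu and sigma applied to any
   one of its points.  When f < 0 and N >= 4, a positive point satisfies
   D < 2R (then nu raises D and sigma lowers R) or NR < 2D (then nu lowers D
   and sigma raises R).  Descending therefore stops at a point with D <= R or
   NR <= D; from there one alternating direction increases forever and the
   other never meets the positive quadrant, so this point is the minimum.
   Complements transport tight fusion frames along positive orbit points, so
   one exists on the orbit iff it exists at the minimum, where R <= D <= NR
   forces R = D or D = NR.
   For an equi-isoclinic frame, R > D/2 makes two subspaces meet, hence all
   coincide, hence R = D.  Applying this to the frame and to its Naimark
   complement gives f >= 0 unless R = D, D = NR or NR - D = R. *)

Require Import Defs.
From mathcomp Require Import all_boot all_order all_algebra.
From mathcomp Require Import zify ring.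
From mathcomp Require Import sesquilinear spectral complex.
From mathcomp Require Import boolp classical_sets cardinality reals.

Set Implicit Arguments.
Unset Strict Implicit.
Unset Printing Implicit Defensive.

Import Order.TTheory GRing.Theory Num.Theory.
Local Open Scope ring_scope.
Local Open Scope sesquilinear_scope.
Local Open Scope classical_set_scope.

(** * Orbits *)

Definition step (b : bool) : triple -> triple := if b then nu else sigma.

Lemma stepK b : involutive (step b).
Proof. by case: b => -[[D N] R]; rewrite /step /nu /sigma; congr (_, _, _); lia. Qed.

Lemma step_group b : nu_sigma_group (step b).
Proof. by case: b; constructor. Qed.

(** The alternating word of length [k] whose first applied letter is [step b]; the parity of [j]
    switches the letter each time. *)
Fixpoint walk (b : bool) (k : nat) (p : triple) : triple :=
  if k is j.+1 then step (b (+) odd j) (walk b j p) else p.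

(** Concluding with an equivalence lets the induction pass through inverses: the claim for [g] at
    [h q] is the claim for [h] at [q]. *)
Lemma group_invariant (S : triple -> Prop) g :
  (forall c q, S q -> S (step c q)) -> nu_sigma_group g ->
  forall q, S (g q) <-> S q.
Proof.
move=> Sstep.
have Siff c q : S (step c q) <-> S q.
  by split=> [/(Sstep c)|/Sstep//]; rewrite stepK.
elim=> {g} [q|q|q|g h _ IHg _ IHh q|g h _ IHg gK hK q] //=.
- exact: (Siff true).
- exact: (Siff false).
- by rewrite IHg.
- by rewrite -IHg hK.
Qed.

Lemma Orb_refl D N R : Orb D N R (D, N, R).
Proof. by exists id => //; constructor. Qed.

Lemma Orb_step D N R c q : Orb D N R q -> Orb D N R (step c q).
Proof.
move=> [g Gg ->]; exists (step c \o g) => //.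
exact/nsg_comp/Gg/step_group.
Qed.

(** A further letter either cancels the last letter of an alternating word or prolongs the
    alternation. *)
Lemma OrbP D N R q : Orb D N R q <-> exists b k, q = walk b k (D, N, R).
Proof.
split=> [[g Gg ->]|[b [k ->]]]; last first.
  by elim: k => [|k IHk]; [exact: Orb_refl|exact: Orb_step].
apply/(group_invariant (S := fun q => exists b k, q = walk b k (D, N, R)) _ Gg); last first.
  by exists true, 0%N.
move=> c _ [b [[|k] ->]]; first by exists c, 1%N; rewrite /= addbF.
have [->|c_neq] := eqVneq c (b (+) odd k).
  by exists b, k; rewrite /= stepK.
exists b, k.+2 => /=; congr step.
by move: c_neq; case: (c) (b) (odd k) => [] [] [].
Qed.

(** The points whose orbit contains [q] form a step-stable set, so no inverse need be written
    out. *)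
Lemma Orb_trans D N R D' R' q :
  Orb D N R (D', N, R') -> Orb D' N R' q <-> Orb D N R q.
Proof.
move=> [g Gg eg]; rewrite /Orb /= eg.
apply: (group_invariant (S := fun x => exists2 h, nu_sigma_group h & q = h x)) Gg _.
move=> c x [h Gh ->]; exists (h \o step c); last by rewrite /= stepK.
exact/nsg_comp/step_group.
Qed.

Lemma Orb_invariant D N R D' N' R' :
  Orb D N R (D', N', R') -> N' = N /\ f D' N' R' = f D N R.
Proof.
move=> [g Gg eg].
suff: forall q, (g q).1.2 = q.1.2 /\
    f (g q).1.1 (g q).1.2 (g q).2 = f q.1.1 q.1.2 q.2.
  by move=> /(_ (D, N, R)); rewrite -eg.
move=> q; apply/(group_invariant
  (S := fun x => x.1.2 = q.1.2 /\ f x.1.1 x.1.2 x.2 = f q.1.1 q.1.2 q.2) _ Gg) => //.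
by move=> [] [[D1 N1] R1] /= [<- <-]; split=> //; rewrite /f; ring.
Qed.

(** * Ascending and terminal points *)

(** [step b] raises a coordinate and the other letter lowers one. *)
Definition ascending (b : bool) (N D R : int) : Prop :=
  [/\ 0 < D, 0 < R & if b then D < 2 * R /\ 2 * D < N * R
                     else 2 * R < D /\ N * R < 2 * D].

(** The letter other than [step b] leaves the positive quadrant. *)
Definition terminal (b : bool) (N D R : int) : Prop :=
  [/\ 0 < D, 0 < R & if b then D <= R else N * R <= D].

Lemma terminal_ascending b N D R : 4 <= N -> terminal b N D R -> ascending b N D R.
Proof. by move=> N4 [D0 R0]; case: b => h; split=> //; split; nia. Qed.

(** After a raising step the other letter becomes the raising one, because N - 2 >= 2. The bound on
    the sum makes the walk unbounded. *)
Lemma walk_ascending b N D R k : 4 <= N -> ascending b N D R ->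
  exists D' R', [/\ walk b k (D, N, R) = (D', N, R'),
    ascending (b (+) odd k) N D' R', D <= D', R <= R' & D + R + k%:Z <= D' + R'].
Proof.
move=> N4 asc; elim: k => [|k [D' [R' [/= -> asc' leD leR le_sum]]]].
  by exists D, R; split; rewrite ?addbF //; lia.
have [D'0 R'0] := asc'; rewrite addbN; case: (b (+) odd k) => /= -[h1 h2].
  by exists (N * R' - D'), R'; split=> //; [split=> //; [lia|split]|..]; nia.
by exists D', (D' - R'); split=> //; [split=> //; [lia|split]|..]; nia.
Qed.

(* On the far side of a terminal point the negated triples ascend. *)
Lemma walk_nonpos b N D R k : 4 <= N -> terminal b N D R ->
  exists D' R', walk (~~ b) k.+1 (D, N, R) = (D', N, R') /\ (D' <= 0 \/ R' <= 0).
Proof.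
move=> N4 [D0 R0 term]; case: k => [|k].
  by case: b term => /= h; [exists D, (D - R)|exists (N * R - D), R]; split=> //; lia.
(* The negated point satisfies the ascending inequalities, except that the coordinate changed by the
   next letter may be zero, as happens when D = R or D = NR. *)
suff [D' [R' [-> D'0 R'0 _]]] : exists D' R',
    [/\ walk (~~ b) k.+2 (D, N, R) = (D', N, R'), D' <= 0, R' <= 0
      & if ~~ b (+) odd k then R' < 0 /\ 2 * R' < D' /\ N * R' < 2 * D'
        else D' < 0 /\ D' < 2 * R' /\ 2 * D' < N * R'].
  by exists D', R'; split=> //; left.
elim: k => [|k [D' [R' [eqw D'0 R'0 h]]]].
  case: b term => /= h.
    by exists (N * (D - R) - D), (D - R); split=> //; nia.
  by exists (N * R - D), (N * R - D - R); split=> //; nia.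
have -> : walk (~~ b) k.+3 (D, N, R) =
    step (~~ b (+) odd k) (walk (~~ b) k.+2 (D, N, R)) by rewrite /= negbK.
rewrite eqw /= addbN; case: (~~ b (+) odd k) h => /= -[h1 [h2 h3]].
  by exists (N * R' - D'), R'; split=> //; nia.
by exists D', (D' - R'); split=> //; nia.
Qed.

(** Since 2f = D(NR - 2D) + NR(D - 2R), the two brackets cannot both be nonnegative. *)
Lemma f_neg_cases (N D R : int) : 4 <= N -> 0 < D -> 0 < R -> f D N R < 0 ->
  D < 2 * R \/ N * R < 2 * D.
Proof.
rewrite /f => N4 D0 R0 h; case: (ltP D (2 * R)) => h1; first by left.
right; rewrite ltNge; apply/negP => h2; nia.
Qed.

(** Strong induction on D + R: when R < D < NR both letters stay in the positive quadrant, and one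
    of them lowers the sum while f is unchanged. *)
Lemma terminal_exists (D N R : int) : 4 <= N -> 0 < D -> 0 < R -> f D N R < 0 ->
  exists b D0 R0, Orb D N R (D0, N, R0) /\ terminal b N D0 R0.
Proof.
move=> N4; have [n] := ubnP (absz (D + R)).
elim: n D R => // n IHn D R lt_n D0 R0 f0.
have descend c D' R' : step c (D, N, R) = (D', N, R') -> 0 < D' -> 0 < R' ->
    D' + R' < D + R -> exists b D0 R0, Orb D N R (D0, N, R0) /\ terminal b N D0 R0.
  move=> eqs D'0 R'0 lt_sum; have orb' := Orb_step c (Orb_refl D N R).
  rewrite eqs in orb'; have [_ f'] := Orb_invariant orb'.
  have [||||b [D1 [R1 [orb1 term]]]] := IHn D' R'; rewrite ?f' //; first by lia.
  by exists b, D1, R1; split=> //; apply/(Orb_trans _ orb').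
case: (lerP D R) => leDR; first by exists true, D, R; split=> //; exact: Orb_refl.
case: (lerP (N * R) D) => leNRD; first by exists false, D, R; split=> //; exact: Orb_refl.
have [lt1|lt2] := f_neg_cases N4 D0 R0 f0.
  by apply: (descend false D (D - R)); rewrite // ?subr_gt0 //; lia.
by apply: (descend true (N * R - D) R); rewrite // ?subr_gt0 //; lia.
Qed.

Section Terminal.
Variables (N D0 R0 : int) (b : bool).
Hypotheses (N4 : 4 <= N) (term : terminal b N D0 R0).

(** Of the two alternating directions, [b] stays positive and the other leaves the quadrant at once
    and never returns. *)
Lemma Orb_posP q : Orb_pos D0 N R0 q <-> exists k, q = walk b k (D0, N, R0).
Proof.
have asc := terminal_ascending N4 term.
split=> [[/OrbP [c [k ->]] [pD pR]]|[k ->]]; last first.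
  have [D' [R' [eqw [D'0 R'0 _] _ _ _]]] := walk_ascending k N4 asc.
  by split; [apply/OrbP; exists b, k|rewrite eqw].
have [<-|neq] := eqVneq c b; first by exists k.
have {neq} ec : c = ~~ b by case: (c) (b) neq => [] [].
case: k => [|k] in pD pR *; first by exists 0%N.
have [D' [R' [eqw h]]] := walk_nonpos k N4 term.
by move: pD pR; rewrite ec eqw /=; lia.
Qed.

Lemma terminal_least : least_point (Orb_pos D0 N R0) D0 N R0.
Proof.
split=> [|D' R' /Orb_posP [k]]; first by apply/Orb_posP; exists 0%N.
have [D1 [R1 [-> _ leD leR _]]] := walk_ascending k N4 (terminal_ascending N4 term).
by case=> -> ->.
Qed.

Lemma Orb_pos_infinite : infinite_set (Orb_pos D0 N R0).
Proof.
move=> /(finite_image (fun q : triple => absz (q.1.1 + q.2))) /finite_seqP [s eqs].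
(* After this many steps D + R exceeds every value in the supposed finite list. *)
pose k := (\max_(i <- s) i).+1.
have [D' [R' [eqw _ _ _ le_sum]]] :=
  walk_ascending k N4 (terminal_ascending N4 term).
have: absz (D' + R') \in s.
  suff: [set` s] (absz (D' + R')) by [].
  by rewrite -eqs; exists (D', N, R') => //; apply/Orb_posP; exists k.
move=> in_s; have := leq_bigmax_seq (P := xpredT) (F := id) _ in_s isT; case: term => ? ? _; rewrite /k in le_sum; lia.
Qed.

Lemma Orb_pos_proper : exists q, Orb D0 N R0 q /\ ~ Orb_pos D0 N R0 q.
Proof.
have [D' [R' [eqw h]]] := walk_nonpos 0 N4 term.
exists (D', N, R'); split; first by apply/OrbP; rewrite -eqw; do 2 eexists.
by case=> _ /=; lia.
Qed.

End Terminal.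

(** * Tight frames of isometries *)

Section Frames.
Variable C : numClosedFieldType.

Local Notation "B ^!" :=
  (orthomx Num.conj (mx_of_hermitian (hermitian1mx _)) B) : matrix_set_scope.

Lemma adjM m n p (A : 'M[C]_(m, n)) (B : 'M[C]_(n, p)) :
  (A *m B)^t* = B^t* *m A^t*.
Proof. by rewrite trmx_mul map_mxM. Qed.

Lemma adjZ m n a (A : 'M[C]_(m, n)) : (a *: A)^t* = a^* *: A^t*.
Proof. by rewrite linearZ map_mxZ. Qed.

Lemma proj_ortho_unitary r d p (F : 'M[C]_(r, d)) (U : 'M[C]_(p, d)) :
  F \is unitarymx -> (F :=: U)%MS -> proj_ortho U = F^t* *m F.
Proof.
move=> uF eFU; set P := F^t* *m F.
(* Split the identity as (1 - P) + P: the projection kills the first summand, whose rows are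
   orthogonal to [U], and fixes the second, whose rows lie in [U]. *)
rewrite -[LHS]mul1mx -(subrK P 1%:M) mulmxDl [X in X + _]proj_ortho_0 ?add0r.
  by rewrite proj_ortho_id // -eFU submxMl.
rewrite -(eqmx_ortho _ eFU); apply/orthomx1P.
by rewrite mulmxBl mul1mx /P mulmxtVK // subrr.
Qed.

Lemma proj_ortho_orthomx p d (U : 'M[C]_(p, d)) :
  proj_ortho U^!%MS = 1%:M - proj_ortho U.
Proof. by rewrite -[in RHS](add_proj_ortho U 1%:M) !mul1mx addrC addKr. Qed.

Lemma unitary_basis p d r (U : 'M[C]_(p, d)) : \rank U = r ->
  exists F : 'M[C]_(r, d), F \is unitarymx /\ (F :=: U)%MS.
Proof.
move=> <-; exists (schmidt (row_base U)); split.
  exact/schmidt_unitarymx/rank_leq_col.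
exact/(eqmx_trans (eqmx_schmidt_free (row_base_free _)))/eq_row_base.
Qed.

Lemma eqmx_proj_ortho p q d (U : 'M[C]_(p, d)) (V : 'M[C]_(q, d)) :
  (U :=: V)%MS -> proj_ortho U = proj_ortho V.
Proof.
move=> eUV; have [F [uF eF]] := unitary_basis (erefl (\rank U)).
by rewrite !(proj_ortho_unitary uF) //; exact: eqmx_trans eF eUV.
Qed.

Lemma mxtrace_proj_ortho p d (U : 'M[C]_(p, d)) :
  \tr (proj_ortho U) = (\rank U)%:R.
Proof.
have [F [uF eF]] := unitary_basis (erefl (\rank U)).
by rewrite (proj_ortho_unitary uF eF) mxtrace_mulC (unitarymxP uF) mxtrace1.
Qed.

Lemma mxtrace_mul_compl d (P Q : 'M[C]_d) :
  \tr ((1%:M - P) *m (1%:M - Q)) = d%:R - \tr P - \tr Q + \tr (P *m Q).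
Proof.
rewrite mulmxBl !mulmxBr !mul1mx !mulmx1 !raddfB /= mxtrace1; ring.
Qed.

(* The rows of [F i] are an orthonormal basis of the [i]-th subspace. *)
Definition tight_frame (n r d : nat) (A : C) (F : 'I_n -> 'M[C]_(r, d)) :=
  (forall i, F i \is unitarymx) /\ \sum_i (F i)^t* *m F i = A%:M.

Lemma tight_frame_trace n r d A (F : 'I_n -> 'M[C]_(r, d)) :
  tight_frame A F -> A * d%:R = (n * r)%:R.
Proof.
move=> [uF /(congr1 mxtrace)]; rewrite mxtrace_scalar mulr_natr => <-.
rewrite raddf_sum /= (eq_bigr (fun=> r%:R)) => [|i _].
  by rewrite sumr_const card_ord natrM mulr_natl.
by rewrite mxtrace_mulC (unitarymxP (uF i)) mxtrace1.
Qed.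

Lemma adj_mxcol n r d (F : 'I_n -> 'M[C]_(r, d)) :
  (\mxcol_i F i)^t* = \mxrow_i (F i)^t*.
Proof. by rewrite tr_mxcol; apply/matrixP => i j; rewrite !mxE. Qed.

Lemma mxcol_gram n r d (F : 'I_n -> 'M[C]_(r, d)) :
  (\mxcol_i F i)^t* *m (\mxcol_i F i) = \sum_i (F i)^t* *m F i.
Proof. by rewrite adj_mxcol mul_mxrow_mxcol. Qed.

(** Each block has r independent rows in dimension d, and the invertible d by d matrix A factors
    through the nr stacked rows. *)
Lemma tight_frame_bounds n r d A (F : 'I_n -> 'M[C]_(r, d)) :
  (0 < n)%N -> A != 0 -> tight_frame A F -> (r <= d <= n * r)%N.
Proof.
move=> n0 A0 [uF sF]; apply/andP; split.
  by rewrite -(mxrank_unitary (uF (Ordinal n0))) rank_leq_col.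
have <- : (\sum_(i < n) r = n * r)%N by rewrite sum_nat_const card_ord.
have := mxrankM_maxr ((\mxcol_i F i)^t*) (\mxcol_i F i).
rewrite mxcol_gram sF mxrank_unit.
  by move=> /leq_trans; apply; rewrite rank_leq_row.
by rewrite -scalemx1 unitmxZ ?unitmx1 // unitfE.
Qed.

Lemma adjK_sqrtC (a : C) : 0 <= a -> sqrtC a * (sqrtC a)^* = a.
Proof.
move=> a0; rewrite (CrealP _) ?ger0_real ?sqrtC_ge0 //.
by rewrite -expr2 sqrtCK.
Qed.

(* Normalising the stacked frame gives orthonormal columns; the Naimark
   complement consists of the blocks of a rescaled orthonormal completion. *)
Lemma naimark_exists n r d d' A (F : 'I_n -> 'M[C]_(r, d)) :
  (0 < d)%N -> (0 < d')%N -> (d + d' = n * r)%N -> tight_frame A F ->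
  exists2 G : 'I_n -> 'M[C]_(r, d'), tight_frame ((n * r)%:R / d'%:R) G &
    forall i j, i != j -> G j *m (G i)^t* =
      - (d%:R / d'%:R) *: (F j *m (F i)^t*).
Proof.
move=> d0 d'0 dd' tF; have [uF sF] := tF.
have d0C : d%:R != 0 :> C by rewrite pnatr_eq0 -lt0n.
have d'0C : d'%:R != 0 :> C by rewrite pnatr_eq0 -lt0n.
have nrC : (n * r)%:R != 0 :> C by rewrite pnatr_eq0 -dd' addn_eq0 negb_and -lt0n d0.
have eA : A = (n * r)%:R / d%:R by rewrite -(tight_frame_trace tF) mulfK.
pose m := (\sum_(i < n) r)%N.
have em : m = (n * r)%N by rewrite /m sum_nat_const card_ord.
pose Phi : 'M[C]_(m, d) := \mxcol_i F i.
have gram : Phi^t* *m Phi = A%:M by rewrite mxcol_gram.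
(* Scaling by the inverse root of A makes the columns of [Phi] orthonormal. *)
pose s := sqrtC A^-1.
have ss : s * s^* = A^-1.
  by rewrite adjK_sqrtC // invr_ge0 eA divr_ge0 ?ler0n.
pose W := s *: Phi^t*.
have uW : W \is unitarymx.
  apply/unitarymxP; rewrite /W adjZ trmxCK -scalemxAl -scalemxAr scalerA ss gram.
  by rewrite -mul_scalar_mx -scalar_mxM mulVf // eA mulf_neq0 ?invr_eq0.
have rkW : \rank W^!%MS = d' by rewrite rank_ortho mxrank_unitary // em -dd' addKn.
have [W' [uW' eW']] := unitary_basis rkW.
(* Projections onto orthogonal complements sum to the identity. *)
have eq1 : W'^t* *m W' = 1%:M - A^-1 *: (Phi *m Phi^t*).
  rewrite -(proj_ortho_unitary uW' eW') proj_ortho_orthomx.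
  rewrite (proj_ortho_unitary uW (eqmx_refl _)) /W adjZ trmxCK.
  by rewrite -scalemxAl -scalemxAr scalerA mulrC ss.
(* This scale makes each block unitary: the diagonal factor is (nr/d')(1 - d/(nr)) = 1. *)
pose t := sqrtC ((n * r)%:R / d'%:R : C).
have tt : t * t^* = (n * r)%:R / d'%:R by rewrite adjK_sqrtC // divr_ge0 ?ler0n.
pose Psi := t *: W'^t*.
pose G i : 'M[C]_(r, d') := submxcol Psi i.
have ePsi : \mxcol_i G i = Psi by exact: submxcolK.
have ePP : Psi *m Psi^t* = ((n * r)%:R / d'%:R) *: (1%:M - A^-1 *: (Phi *m Phi^t*)).
  by rewrite /Psi adjZ trmxCK -scalemxAl -scalemxAr scalerA tt eq1.
have GG i j : G i *m (G j)^t* = ((n * r)%:R / d'%:R) *: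
     ((if i == j then 1%:M else 0) - A^-1 *: (F i *m (F j)^t*)).
  have sub k (X : 'M[C]_(m, k)) :
      submxcol X i *m (submxcol X j)^t* = submxblock (X *m X^t*) i j.
    rewrite submxblockEh -mul_submxrow -submxcol_mul; congr (_ *m _).
    by apply/matrixP => a b; rewrite !mxE.
  have subZ a (X : 'M[C]_m) : submxblock (a *: X) i j = a *: submxblock X i j.
    by apply/matrixP => k l; rewrite !mxE.
  rewrite sub ePP subZ submxblockB subZ -sub !mxcolK -mxdiagZ mxblockK.
  by rewrite conform_mx_id.
exists G; first split.
- move=> i; apply/unitarymxP; rewrite GG eqxx (unitarymxP (uF i)).
  rewrite -scalemx1 -[X in X - _]scale1r -scalerBl scalerA; rewrite -[1%:M in RHS]scale1r; congr (_ *: _).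
  have -> : (n * r)%:R = d%:R + d'%:R :> C by rewrite -dd' natrD.
  rewrite eA -dd' natrD; field.
  by rewrite -natrD dd' nrC d'0C d0C.
- rewrite -mxcol_gram ePsi /Psi adjZ trmxCK -scalemxAl -scalemxAr.
  by rewrite scalerA mulrC tt (unitarymxP uW') scalemx1.
- move=> i j /negPf neq; rewrite GG eq_sym neq sub0r scalerN scalerA scaleNr.
  congr (- (_ *: _)); rewrite eA; field.
  by move: nrC; rewrite natrM mulf_eq0 negb_or d'0C d0C => /andP [-> ->].
Qed.

(** The condition P_i P_j P_i = l P_i, read in the orthonormal basis of the i-th subspace. *)
Definition isoclinic n r d (l : C) (F : 'I_n -> 'M[C]_(r, d)) :=
  forall i j, i != j -> F i *m (F j)^t* *m (F j *m (F i)^t*) = l%:M.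

(* When [d < 2 r] two of the row spaces share a nonzero vector, which forces
   [l = 1], so that the tight frame bound is [n]. *)
Lemma isoclinic_dim n r d A l (F : 'I_n -> 'M[C]_(r, d)) :
  (1 < n)%N -> tight_frame A F -> isoclinic l F -> (r = d \/ 2 * r <= d)%N.
Proof.
move=> n1 tF eiF; have [uF sF] := tF.
case: (leqP (2 * r) d) => lt_dr; [by right|left].
pose i0 := Ordinal (ltnW n1); pose i1 := Ordinal n1.
have /rowV0Pn [v] : (F i0 :&: F i1)%MS != 0.
  rewrite -mxrank_eq0 -lt0n.
  have := mxrank_sum_cap (F i0) (F i1); rewrite (mxrank_unitary (uF i0)) (mxrank_unitary (uF i1)).
  by have := rank_leq_col (F i0 + F i1)%MS; lia.
rewrite sub_capmx => /andP [/submxP [a ea] /submxP [b eb]] v0.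
have a0 : a != 0 by apply: contraNneq v0 => a0; rewrite ea a0 mul0mx.
(* The coordinates of the common vector in either basis determine those in the other; going round
   gives a = l a. *)
have ab : b = a *m F i0 *m (F i1)^t* by rewrite -ea eb mulmxtVK.
have ba : a = b *m F i1 *m (F i0)^t* by rewrite -eb ea mulmxtVK.
have l1 : l = 1.
  have : a = l *: a.
    rewrite [LHS]ba ab -!mulmxA (mulmxA (F i0)) eiF //.
    by rewrite mul_mx_scalar.
  move/eqP; rewrite -[X in X == _]scale1r -subr_eq0 -scalerBl scaler_eq0 (negPf a0).
  by rewrite orbF subr_eq0 => /eqP.
have r0 : (0 < r)%N by lia.
(* Compress the frame identity to the first subspace: since l = 1, each of the n terms becomes the
   identity. *)
have An : A = n%:R.
  have /(congr1 (fun X => F i0 *m X *m (F i0)^t*)) := sF.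
  rewrite mul_mx_scalar -scalemxAl (unitarymxP (uF i0)) mulmx_sumr mulmx_suml.
  rewrite (eq_bigr (fun=> 1%:M)) => [|j _].
    rewrite sumr_const card_ord -scaler_nat !scalemx1 => /(congr1 mxtrace).
    rewrite !mxtrace_scalar -[LHS]mulr_natr -[RHS]mulr_natr.
    by move/mulIf => -> //; rewrite pnatr_eq0 -lt0n.
  have [<-|neq] := eqVneq i0 j.
    by rewrite mulmxA (unitarymxP (uF i0)) mul1mx (unitarymxP (uF i0)).
  by rewrite mulmxA -mulmxA eiF // l1.
have := tight_frame_trace tF; rewrite An -natrM => /eqP.
by rewrite eqr_nat eqn_pmul2l 1?ltnW // => /eqP.
Qed.

(** * Traces of products of projections *)

Lemma mxtrace_gram_ge0 m n (X : 'M[C]_(m, n)) : 0 <= \tr (X *m X^t*).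
Proof.
apply: sumr_ge0 => i _; rewrite mxE; apply: sumr_ge0 => j _.
by rewrite !mxE mul_conjC_ge0.
Qed.

(** The trace is the squared Frobenius norm of the cross-Gram matrix: it is nonnegative, and
    rescaling that matrix rescales it. *)
Lemma mxtrace_gram r d (F G : 'M[C]_(r, d)) :
  \tr (F^t* *m F *m (G^t* *m G)) = \tr ((G *m F^t*) *m (G *m F^t*)^t*).
Proof. by rewrite adjM trmxCK mulmxA mxtrace_mulC !mulmxA. Qed.

(** Multiplying the identity sum of P_k = 1 by P_i and taking traces, the nonnegative traces with k
    different from i add up to zero. *)
Lemma tight_frame1_ortho n r d (F : 'I_n -> 'M[C]_(r, d)) i j :
  tight_frame 1 F -> i != j -> \tr ((F i)^t* *m F i *m ((F j)^t* *m F j)) = 0.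
Proof.
move=> [uF sF] neq; set P := fun i => (F i)^t* *m F i.
have : \sum_(k | k != i) \tr (P i *m P k) = 0.
  have : \sum_k \tr (P i *m P k) = \tr (P i *m P i).
    rewrite -raddf_sum /= -mulmx_sumr sF mulmx1 /P -mulmxA (mulmxA (F i)).
    by rewrite (unitarymxP (uF i)) mul1mx.
  rewrite (bigD1 i) //= => e.
  by apply: (addrI (\tr (P i *m P i))); rewrite e addr0.
move/eqP; rewrite psumr_eq0 => [|k _]; last by rewrite mxtrace_gram mxtrace_gram_ge0.
by move=> /allP /(_ j); rewrite mem_index_enum eq_sym neq => /(_ isT) /eqP.
Qed.

(** * The two extremal frames: R = D and D = NR *)

Lemma tight_frame_full n d : exists F : 'I_n -> 'M[C]_(d, d), tight_frame n%:R F.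
Proof.
exists (fun=> 1%:M); split=> [i|].
  by apply/unitarymxP; rewrite trmx1 map_mx1 mulmx1.
by rewrite trmx1 map_mx1 mulmx1 sumr_const card_ord -scaler_nat scalemx1.
Qed.

Lemma tight_frame_ortho n r d : d = (n * r)%N ->
  exists F : 'I_n -> 'M[C]_(r, d), tight_frame 1 F.
Proof.
have <- : (\sum_(i < n) r = n * r)%N by rewrite sum_nat_const card_ord.
move=> ->; pose F i : 'M[C]_(r, \sum_(i < n) r) := submxcol 1%:M i.
have eF : \mxcol_i F i = 1%:M by exact: submxcolK.
exists F; split=> [i|]; last by rewrite -mxcol_gram eF trmx1 map_mx1 mulmx1.
apply/unitarymxP.
have : (\mxcol_i F i) *m (\mxcol_i F i)^t* = 1%:M.
  by rewrite eF trmx1 map_mx1 mulmx1.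
rewrite adj_mxcol mul_mxcol_mxrow -mxdiagZ.
move=> /(congr1 (fun X => submxblock X i i)).
by rewrite mxblockK submxblock_diag.
Qed.

End Frames.

(** * Tight fusion frames and complements *)

Section TightFusionFrames.
Variable K : realType.

Lemma absz_ratio (D E : int) : 0 <= D -> 0 <= E ->
  D%:~R / E%:~R = (absz D)%:R / (absz E)%:R :> K[i].
Proof. by move=> D0 E0; rewrite -{1}(gez0_abs D0) -{1}(gez0_abs E0). Qed.

(** Choosing an orthonormal basis of each subspace turns projections into Gram products, to which
    the frame lemmas apply. *)
Lemma is_TFFP D N R (U : subspaces K D N) :
  is_TFF R U <-> [/\ 0 < D, 1 < N, 0 < R
    & exists (F : 'I_(absz N) -> 'M[K[i]]_(absz R, absz D)) (A : K[i]),
        [/\ 0 < A, tight_frame A F & forall n, (F n :=: U n)%MS]].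
Proof.
split=> [[D0 N1 R0 rkU [A A0 sA]]|[D0 N1 R0 [F [A [A0 [uF sF] eF]]]]]; split=> //.
- have /choice [F FP] : forall n, exists Fn : 'M[K[i]]_(absz R, absz D),
      Fn \is unitarymx /\ (Fn :=: U n)%MS.
    by move=> n; apply: unitary_basis; rewrite -(rkU n).
  exists F, A; split=> // [|n]; last by case: (FP n).
  split=> [n|]; first by case: (FP n).
  rewrite -sA; apply: eq_bigr => n _.
  by rewrite (proj_ortho_unitary (FP n).1 (FP n).2).
- by move=> n; rewrite -(eF n) mxrank_unitary // gez0_abs // ltW.
- exists A => //; rewrite -sF; apply: eq_bigr => n _.
  exact: proj_ortho_unitary (uF n) (eF n).
Qed.

Lemma TFF_bounds D N R (U : subspaces K D N) :
  is_TFF R U -> R <= D /\ D <= N * R.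
Proof.
move=> /is_TFFP [D0 N1 R0 [F [A [A0 tF _]]]].
have N0 : (0 < absz N)%N by lia.
have /andP [h1 h2] := tight_frame_bounds N0 (lt0r_neq0 A0) tF.
by split; first lia; rewrite -abszM in h2; nia.
Qed.

Lemma spatial_TFF D N R (U V : subspaces K D N) :
  is_TFF R U -> spatial_complement R U V -> is_TFF (D - R) V.
Proof.
move=> tU [neDR eV]; have [leRD _] := TFF_bounds tU.
have [D0 N1 R0 [F [A [A0 tF eF]]]] := (is_TFFP _ _).1 tU.
have [_ _ _ rkU [A' A'0 sA]] := tU.
have ltRD : R < D by rewrite lt_neqAle leRD andbT; apply/eqP => /esym.
split=> // [|n|]; first by rewrite subr_gt0.
  rewrite (eV n) /orthocomp rank_ortho. have := rkU n; move: (\rank _) => r; lia.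
(* The complementary projections sum to N - A', which is positive because A' D = NR and R < D. *)
exists ((absz N)%:R - A').
  have eA : A' = A.
    have D0' : (0 < absz D)%N by lia.
    move/matrixP: sA => /(_ (Ordinal D0') (Ordinal D0')).
    case: tF => uF /matrixP /(_ (Ordinal D0') (Ordinal D0')).
    rewrite (eq_bigr (fun i => proj_ortho (U i))) => [-> /=|n _]; last first.
      by rewrite (proj_ortho_unitary (uF n) (eF n)).
    by rewrite !mxE eqxx !mulr1n => ->.
  have := tight_frame_trace tF; rewrite eA => trA.
  have D0C : 0 < (absz D)%:R :> K[i] by rewrite ltr0n; lia.
  rewrite -(pmulr_lgt0 _ D0C) mulrBl trA -natrM subr_gt0 ltr_nat.
  by rewrite ltn_pmul2l; lia.
under eq_bigr => n _ do rewrite (eqmx_proj_ortho (eV n)) /orthocomp proj_ortho_orthomx.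
by rewrite big_split /= sumrN sA sumr_const card_ord -scaler_nat scalemx1 -raddfB.
Qed.

Lemma naimark_frame_exists D N R (F : 'I_(absz N) -> 'M[K[i]]_(absz R, absz D)) A :
  0 < D -> 1 < N -> 0 < R -> D < N * R -> tight_frame A F ->
  exists (G : 'I_(absz N) -> 'M[K[i]]_(absz R, absz (N * R - D)%R)) (B : K[i]),
    [/\ 0 < B, tight_frame B G & forall n1 n2, n1 != n2 ->
          G n2 *m (G n1)^t* =
            - (D%:~R / (N * R - D)%:~R) *: (F n2 *m (F n1)^t*)].
Proof.
move=> D0 N1 R0 ltD tF.
have [||| G tG GF] := @naimark_exists _ _ _ _ (absz (N * R - D)%R) _ _ _ _ _ tF; try nia.
eexists G, _; split; [|exact: tG|by move=> n1 n2 /GF ->; rewrite absz_ratio //; lia].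
by rewrite divr_gt0 // ltr0n ?muln_gt0; lia.
Qed.

Lemma naimark_TFF_exists D N R (U : subspaces K D N) :
  is_TFF R U -> D < N * R -> exists V : subspaces K (N * R - D) N,
    @naimark_complement K D N R U V /\ is_TFF R V.
Proof.
move=> /is_TFFP [D0 N1 R0 [F [A [A0 tF eF]]]] ltD.
have [G [B [B0 tG GF]]] := naimark_frame_exists D0 N1 R0 ltD tF.
(* [subspaces] requires square matrices, so each block is replaced by the projection onto its row
   space. *)
have eG n : (G n :=: (G n)^t* *m G n)%MS.
  apply/eqmxP; rewrite submxMl andbT -[X in (X <= _)%MS]mul1mx.
  by rewrite -(unitarymxP (tG.1 n)) -mulmxA submxMl.
exists (fun n => (G n)^t* *m G n); split; last first.
  by apply/is_TFFP; split=> //; [lia|exists G, B].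
split; first lia.
exists F, G; split=> // n; [by split; [exact: tF.1|]|by split; [exact: tG.1|]].
Qed.

(** * Existence along orbits and equi-isoclinic frames *)

(** Positivity of the new point is what allows the complement to be taken. *)
Lemma TFF_exists_step c D N R D' R' : step c (D, N, R) = (D', N, R') ->
  0 < D' -> 0 < R' -> TFF_exists K D N R -> TFF_exists K D' N R'.
Proof.
case: c => /= -[<- <-] D'0 R'0 [U tU].
  have [//|V [_ tV]] := naimark_TFF_exists tU _; first lia.
  by exists V.
exists (fun n => orthocomp (U n)); apply: spatial_TFF tU _.
by split=> //; lia.
Qed.

(** The walk is retraced backwards: the letters are involutions and every intermediate point is
    positive. *)
Lemma TFF_exists_walk b N D R k D' R' : 4 <= N -> terminal b N D R ->
  walk b k (D, N, R) = (D', N, R') -> TFF_exists K D' N R' -> TFF_exists K D N R.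
Proof.
move=> N4 term; elim: k D' R' => [D' R' [-> ->] //|k IHk D' R' eqw exT].
have [D2 [R2 [eqw2 [D20 R20 _] _ _ _]]] :=
  walk_ascending k N4 (terminal_ascending N4 term).
apply: (IHk _ _ eqw2); apply: (@TFF_exists_step (b (+) odd k)) exT => //.
by rewrite -eqw /= stepK.
Qed.

Lemma TFF_isoclinic D N R (U : subspaces K D N) : 4 <= N -> f D N R < 0 ->
  is_TFF R U -> equi_isoclinic U -> [\/ R = D, D = N * R | N * R - D = R].
Proof.
move=> N4 f0 tU [l _ eiU]; have [_ leD] := TFF_bounds tU.
have [D0 N1 R0 [F [A [A0 tF eF]]]] := (is_TFFP _ _).1 tU.
have eiF : isoclinic l F.
  move=> i j neq; have := eiU i j neq.
  rewrite !(proj_ortho_unitary (tF.1 _) (eF _)).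
  move=> /(congr1 (fun X => F i *m X *m (F i)^t*)).
  rewrite -scalemxAr -scalemxAl !mulmxA (unitarymxP (tF.1 i)) mul1mx.
  by rewrite (unitarymxP (tF.1 i)) !(mulmxtVK, tF.1) // scalemx1.
have N2 : (1 < absz N)%N by lia.
case: (isoclinic_dim N2 tF eiF) => h1; first by constructor 1; lia.
case: (ltP D (N * R)) => ltD; last by constructor 2; apply/le_anti/andP.
have [G [B [B0 tG GF]]] := naimark_frame_exists D0 N1 R0 ltD tF.
set c : K[i] := - (_ / _) in GF.
(* A Naimark complement multiplies both cross-Gram factors by c. *)
have eiG : isoclinic (c * c * l) G.
  move=> i j neq; have neq' : j != i by rewrite eq_sym.
  rewrite (GF i j neq) (GF j i neq') -scalemxAr -scalemxAl scalerA eiF //.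
  by rewrite scale_scalar_mx.
case: (isoclinic_dim N2 tG eiG) => h2; first by constructor 3; lia.
(* From 2R <= D and 2R <= NR - D follows D(NR - D) >= 2R(NR - 2R), so f >= (N - 4)R^2 >= 0. *)
by move: f0; rewrite /f; nia.
Qed.

(** * Equichordality under complements *)

Definition constant_rank D N (U : subspaces K D N) :=
  exists r, forall n, \rank (U n) = r.

(** The trace of (1 - P)(1 - Q) involves the ranks of P and Q, so equal rank is carried along with
    equichordality. *)
Lemma equichordal_spatial D N R (U V : subspaces K D N) :
  constant_rank U -> equichordal U -> spatial_complement R U V ->
  constant_rank V /\ equichordal V.
Proof.
move=> [r rkU] [c ecU] [_ eV]; split.
  by exists (absz D - r)%N => n; rewrite (eV n) /orthocomp rank_ortho rkU.
exists ((absz D)%:R - r%:R - r%:R + c) => n1 n2 neq.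
have eP n : proj_ortho (V n) = 1%:M - proj_ortho (U n).
  by rewrite (eqmx_proj_ortho (eV n)) /orthocomp proj_ortho_orthomx.
by rewrite (eP n1) (eP n2) mxtrace_mul_compl (ecU n1 n2 neq) !mxtrace_proj_ortho !rkU.
Qed.

Lemma equichordal_naimark D N R (U : subspaces K D N)
    (V : subspaces K (N * R - D) N) :
  equichordal U -> @naimark_complement K D N R U V ->
  constant_rank V /\ equichordal V.
Proof.
move=> [c ecU] [_ [F [G [hF hG GF]]]]; split.
  exists (absz R) => n; have [uG eG] := hG n.
  by rewrite -(eG : _ :=: _)%MS mxrank_unitary.
set t : K[i] := - (_ / _) in GF; exists (t * t^* * c) => n1 n2 neq.
rewrite -(ecU n1 n2 neq).
rewrite (proj_ortho_unitary (hF n1).1 (hF n1).2) (proj_ortho_unitary (hF n2).1 (hF n2).2).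
rewrite (proj_ortho_unitary (hG n1).1 (hG n1).2) (proj_ortho_unitary (hG n2).1 (hG n2).2).
by rewrite !mxtrace_gram GF // adjZ -scalemxAl -scalemxAr scalerA mxtraceZ.
Qed.

(** If R = D all projections are the identity; if D = NR the frame bound is 1 and the subspaces are
    mutually orthogonal. *)
Lemma equichordal_extremal D N R (U : subspaces K D N) :
  R = D \/ D = N * R -> is_TFF R U -> equichordal U.
Proof.
move=> eDR /is_TFFP [D0 N1 R0 [F [A [A0 tF eF]]]].
case: eDR => e.
  exists (absz D)%:R => n1 n2 _.
  have eD : absz R = absz D by rewrite e.
  have full n : proj_ortho (U n) = 1%:M.
    rewrite (proj_ortho_unitary (tF.1 n) (eF n)) -[LHS]mul1mx mulmxA.
    exact: mulmxKtV (tF.1 n) eD.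
  by rewrite !full mulmx1 mxtrace1.
exists 0 => n1 n2 neq.
rewrite (proj_ortho_unitary (tF.1 n1) (eF n1)) (proj_ortho_unitary (tF.1 n2) (eF n2)).
apply: tight_frame1_ortho neq.
suff <- : A = 1 by [].
have D0C : (absz D)%:R != 0 :> K[i] by rewrite pnatr_eq0; lia.
apply: (mulIf D0C); rewrite (tight_frame_trace tF) mul1r; congr (_%:R); nia.
Qed.

Lemma TFF_exists_extremal D N R : 0 < D -> 1 < N -> 0 < R ->
  R = D \/ D = N * R -> TFF_exists K D N R.
Proof.
move=> D0 N1 R0 eDR.
suff [F [A [A0 tF]]] : exists (F : 'I_(absz N) -> 'M[K[i]]_(absz R, absz D)) A,
    0 < A /\ tight_frame A F.
  exists (fun n => (F n)^t* *m F n); apply/is_TFFP; split=> //.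
  exists F, A; split=> // n; apply/eqmxP; rewrite submxMl andbT.
  by rewrite -[X in (X <= _)%MS]mul1mx -(unitarymxP (tF.1 n)) -mulmxA submxMl.
case: eDR => [->|e].
  have [F tF] := tight_frame_full K[i] (absz N) (absz D).
  by exists F, (absz N)%:R; split=> //; rewrite ltr0n; lia.
have eD : absz D = (absz N * absz R)%N by nia.
by have [F tF] := tight_frame_ortho K[i] eD; exists F, 1.
Qed.

(** * Iterated alternating complements *)

Lemma alternating_Orb D0 N R0 (U0 : subspaces K D0 N) k D R (U : subspaces K D N) :
  alternating_complements R0 U0 k R U -> Orb D0 N R0 (D, N, R).
Proof.
elim=> {k D R U} [U _|k D R U V _ _ IH _|k D R U V _ _ IH _].
- exact: Orb_refl.
- exact: (Orb_step true IH).
- exact: (Orb_step false IH).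
Qed.

Lemma alternating_equichordal D0 N R0 (U0 : subspaces K D0 N) k D R
    (U : subspaces K D N) : R0 = D0 \/ D0 = N * R0 -> is_TFF R0 U0 ->
  alternating_complements R0 U0 k R U -> constant_rank U /\ equichordal U.
Proof.
move=> eDR tU0; elim=> {k D R U} [U eU|k D R U V _ _ [rU ecU] nUV|k D R U V _ _ [rU ecU] sUV].
- have [_ _ _ rkU0 _] := tU0; split.
    by exists (absz R0) => n; rewrite (eU n) -(rkU0 n).
  have [c ec] := equichordal_extremal eDR tU0; exists c => n1 n2 neq.
  by rewrite (eqmx_proj_ortho (eU n1)) (eqmx_proj_ortho (eU n2)) ec.
- exact: equichordal_naimark ecU nUV.
- exact: equichordal_spatial rU ecU sUV.
Qed.

Definition last_kind (b : bool) (k : nat) : option complement_kind :=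
  if k is j.+1 then Some (if b (+) odd j then Naimark else Spatial) else None.

(** Along the ascending walk the next complement always exists: D < NR before a Naimark step and R <
    D before a spatial one. *)
Lemma alternating_walk b D0 N R0 (U0 : subspaces K D0 N) k :
  4 <= N -> terminal b N D0 R0 -> is_TFF R0 U0 ->
  exists D R (U : subspaces K D N), [/\ walk b k (D0, N, R0) = (D, N, R),
    is_TFF R U & alternating_complements R0 U0 (last_kind b k) R U].
Proof.
move=> N4 term tU0; elim: k => [|k [D [R [U [eqw tU altU]]]]].
  by exists D0, R0, U0; split=> //; constructor.
have [D' [R' [eqw' asc _ _ _]]] := walk_ascending k N4 (terminal_ascending N4 term).
move: eqw'; rewrite eqw => -[eD eR]; rewrite -{}eD -{}eR {D' R'} in asc.
(* The next letter differs from the last one, as the alternation rule demands. *)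
have nlast c : b (+) odd k = c ->
    last_kind b k <> Some (if c then Naimark else Spatial).
  by case: k {tU altU eqw asc} => //= j; rewrite addbN => <-; case: (_ (+) _).
rewrite /= eqw; case: (b (+) odd k) asc nlast => -[D'0 R'0 h] /(_ _ erefl) /= nlast.
  have [|V [nUV tV]] := naimark_TFF_exists tU; first lia.
  exists (N * R - D), R, V; split=> //.
  exact: ac_naimark nlast altU nUV.
pose V : subspaces K D N := fun n => orthocomp (U n).
have sUV : spatial_complement R U V by split=> //; lia.
exists D, (D - R), V; split=> //; first exact: spatial_TFF tU sUV.
exact: ac_spatial nlast altU sUV.
Qed.

End TightFusionFrames.

(** * Orbits with f < 0 and their tight fusion frames *)

Theorem theorem3p4 (K : realType) (D N R : int)
    (hD : 0 < D) (hN : 4 <= N) (hR : 0 < R) (hf : f D N R < 0) :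
  infinite_set (Orb_pos D N R) /\
  Orb_pos D N R `<` Orb D N R /\
  (~ exists D1 R1 : int,
      [/\ Orb_pos D N R (D1, N, R1),
          0 < 2 * D1%:Q / N%:Q,
          2 * D1%:Q / N%:Q <= R1%:Q
        & R1%:Q <= D1%:Q / 2]) /\
  (exists! DR : int * int, least_point (Orb_pos D N R) DR.1 N DR.2) /\
  (forall D0 R0 : int, least_point (Orb_pos D N R) D0 N R0 ->
    (~ (R0%:Q = D0%:Q / N%:Q \/ R0 = D0) ->
      forall D' R' : int, Orb D N R (D', N, R') -> ~ TFF_exists K D' N R') /\
    (R0%:Q = D0%:Q / N%:Q \/ R0 = D0 ->
      [/\ TFF_exists K D0 N R0,
          Orb_pos D N R =
            [set q | q.1.2 = N /\
               exists U : subspaces K q.1.1 N, TFF_obtained_from D0 R0 q.2 U],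
          forall (D' R' : int) (U : subspaces K D' N),
            TFF_obtained_from D0 R0 R' U ->
            equichordal U /\
            (equi_isoclinic U -> R' = R0 /\ (D' = D0 \/ D' = N * R0 - D0))
        & [set q | Orb_pos D N R q /\
             (q.2%:Q = q.1.1%:Q / N%:Q \/ q.2 = q.1.1)] = [set (D0, N, R0)]])).
Proof.
have N0Q : 0 < N%:Q by rewrite ltr0z; lia.
have ratioE (D1 R1 : int) : R1%:Q = D1%:Q / N%:Q <-> D1 = N * R1.
  split=> [e|->]; last by rewrite intrM mulrC mulKf // gt_eqF.
  by apply: (@intr_inj rat); rewrite intrM e mulrC divfK // gt_eqF.
have [b [D1 [R1 [orb1 term]]]] := terminal_exists hN hD hR hf.
have eO D2 R2 : Orb D N R (D2, N, R2) -> Orb D2 N R2 = Orb D N R.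
  by move=> o; apply/predeqP => q; exact: Orb_trans o.
have eP D2 R2 : Orb D N R (D2, N, R2) -> Orb_pos D2 N R2 = Orb_pos D N R.
  by rewrite /Orb_pos => /eO ->.
have f_orb D2 R2 : Orb D N R (D2, N, R2) -> f D2 N R2 < 0.
  by move=> /Orb_invariant [_ ->].
have least1 D2 R2 b2 : Orb D N R (D2, N, R2) -> terminal b2 N D2 R2 ->
    least_point (Orb_pos D N R) D2 N R2.
  by move=> o t; rewrite -(eP _ _ o); exact: terminal_least t.
have least_unique D2 R2 D3 R3 : least_point (Orb_pos D N R) D2 N R2 ->
    least_point (Orb_pos D N R) D3 N R3 -> D2 = D3 /\ R2 = R3.
  by move=> [p2 l2] [p3 l3]; have := l2 _ _ p3; have := l3 _ _ p2; lia.
split; first by rewrite -(eP _ _ orb1); exact: Orb_pos_infinite term.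
split.
  have [q [oq npq]] := Orb_pos_proper hN term.
  split=> [x []//|/(_ q)]; rewrite -(eO _ _ orb1) -(eP _ _ orb1) => /(_ oq).
  exact: npq.
split.
  (* Such a point has 2R <= D and 2D <= NR, which forces f >= 0. *)
  move=> [D2 [R2 [[/f_orb f2 [/= D20 R20]] _]]].
  rewrite ler_pdivrMr // ler_pdivlMr // -intrM -[2]/(2%:~R) -!intrM !ler_int.
  by move: f2; rewrite /f; nia.
split.
  exists (D1, R1); split=> [|[D2 R2] l2]; first exact: least1 orb1 term.
  by have [-> ->] := least_unique _ _ _ _ (least1 _ _ _ orb1 term) l2.
move=> D0 R0 least0.
have [e1 e2] := least_unique _ _ _ _ least0 (least1 _ _ _ orb1 term).
subst D1 R1.
have eO0 := eO _ _ orb1; have eP0 := eP _ _ orb1.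
have [D00 R00 tb] := term.
split=> [nextr D' R' orb' exT'|extr].
  have pos' : Orb_pos D0 N R0 (D', N, R').
    by rewrite eP0; split=> //; case: exT' => U [? _ ? _ _].
  have [k ek] := (Orb_posP hN term _).1 pos'.
  (* A frame carried back to the minimum satisfies R0 <= D0 <= N R0; with terminality one of these
     is an equality. *)
  have [U /TFF_bounds bnd] := TFF_exists_walk hN term (esym ek) exT'; apply: nextr.
  by case: (b) tb => tb; [right|left; apply/ratioE]; lia.
have {}extr : R0 = D0 \/ D0 = N * R0 by case: extr => [/ratioE|]; tauto.
have exT0 : TFF_exists K D0 N R0 by apply: TFF_exists_extremal; lia.
(* A positive point with R = D or D = NR is terminal, hence least, hence the minimum. *)
have extremal_unique D2 R2 : Orb D N R (D2, N, R2) -> 0 < D2 -> 0 < R2 ->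
    R2 = D2 \/ D2 = N * R2 -> D2 = D0 /\ R2 = R0.
  move=> o D20 R20 e.
  have [b2 t2] : exists b2, terminal b2 N D2 R2.
    by case: e => ->; [exists true|exists false]; split=> //; rewrite -?e; lia.
  exact: least_unique (least1 _ _ _ o t2) least0.
have obtained_Orb D' R' (U : subspaces K D' N) :
    TFF_obtained_from D0 R0 R' U -> Orb D N R (D', N, R').
  by move=> [_ [U0 [_ [k alt]]]]; rewrite -eO0; exact: alternating_Orb alt.
split=> //.
- apply/predeqP => -[[D' N'] R'] /=; split.
    rewrite -eP0 => /(Orb_posP hN term) [k ek].
    have [U0 tU0] := exT0.
    have [D2 [R2 [U [eqw tU alt]]]] := alternating_walk k hN term tU0.
    move: ek; rewrite eqw => -[-> -> ->].
    by split=> //; exists U; split=> //; exists U0; split=> //; exists (last_kind b k).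
  move=> [/= eN [U oU]]; subst N'; split; first exact: obtained_Orb oU.
  by case: oU => -[].
- move=> D' R' U oU; have oD' := obtained_Orb _ _ _ oU.
  have [tU [U0 [tU0 [k alt]]]] := oU.
  have [_ ecU] := alternating_equichordal extr tU0 alt.
  split=> // eiU; have [D'0 _ R'0 _ _] := tU.
  case: (TFF_isoclinic hN (f_orb _ _ oD') tU eiU) => e.
  + by have := extremal_unique _ _ oD' D'0 R'0; lia.
  + by have := extremal_unique _ _ oD' D'0 R'0; lia.
  (* Here N R' - D' = R', so the Naimark partner is extremal and must be the minimum. *)
  + have /extremal_unique : Orb D N R (N * R' - D', N, R') by exact: (Orb_step true oD').
    lia.
- apply/predeqP => -[[D' N'] R'] /=; split.
    move=> [[o [/= D'0 R'0]] e]; have [eN _] := Orb_invariant o; subst N'.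
    have [|-> -> //] := extremal_unique _ _ o D'0 R'0.
    by case: e => [/ratioE|]; tauto.
  move=> e; have {e} [-> -> ->] : (D', N', R') = (D0, N, R0) by [].
  split; first by case: least0.
  by case: extr => [->|/ratioE]; [right|left].
Qed.
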